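(* Let $R$ be a commutative ring with a derivation $D_R$. If $BM(R)=1$ then $MBM^{\text{diff}}(R)=BM^{\text{diff}}(R)$.
   Context: A differential Azumaya $R$-algebra is an Azumaya $R$-algebra $A$ with a derivation $D_A$ extending $D_R$. Isomorphisms of differential algebras are $R$-algebra isomorphisms commuting with the derivations. The tensor product $A\otimes_R B$ of differential algebras has derivation $D_A\otimes 1+1\otimes D_B$. If $N\subseteq M$ is a submonoid of a commutative monoid, $M/N$ is the monoid of equivalence classes of $M$ under: $m_1\sim m_2$ iff there are $n_1,n_2\in N$ with $m_1n_1=m_2n_2$. If $P\subseteq Q\subseteq M$ are submonoids, $Q/P$ is regarded as a submonoid of $M/P$. For $Z\in M_n(R)$ ($n\ge1$), $(M_n(R),Z)$ denotes $M_n(R)$ with the derivation $Y\mapsto Y'+ZY-YZ$, where $Y'$ is the entrywise derivative. $MA(R)$ is the monoid (under $\otimes_R$) of isomorphism classes of Azumaya $R$-algebras, $MM(R)$ its submonoid of classes of matrix algebras $M_n(R)$, $n\ge1$, and $BM(R)=MA(R)/MM(R)$. $MA^{\text{diff}}(R)$ is the monoid (under $\otimes_R$) of differential isomorphism classes of differential Azumaya $R$-algebras; $MM^{\text{diff}}(R)$ is its submonoid of classes of algebras $(M_n(R),Z)$; $MM_0^{\text{diff}}(R)$ its submonoid of classes of algebras $(M_n(R),0)$. $BM^{\text{diff}}(R)=MA^{\text{diff}}(R)/MM_0^{\text{diff}}(R)$ and its submonoid $MBM^{\text{diff}}(R)=MM^{\text{diff}}(R)/MM_0^{\text{diff}}(R)$.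 *)

(* Defs.v *)
From HB Require Import structures.
From mathcomp Require Import all_boot all_algebra boolp.

Set Implicit Arguments.
Unset Strict Implicit.
Unset Printing Implicit Defensive.

Import GRing.Theory.
Local Open Scope ring_scope.
Local Open Scope quotient_scope.

(* The library's monoidType extends choiceType.  Isomorphism classes of algebras
   form a type in a universe too large for a choiceType, so commutative monoids
   and quotients of large types are defined here without that structure. *)
Record comm_monoid := CommMonoid {
  cm_sort :> Type;
  cm_mul : cm_sort -> cm_sort -> cm_sort;
  cm_one : cm_sort;
  cm_mulA : associative cm_mul;
  cm_mulC : commutative cm_mul;
  cm_mul1 : left_id cm_one cm_mul
}.

Arguments cm_one {c}.

Record submonoid (M : comm_monoid) := Submonoid {
  sm_pred :> M -> Prop;
  sm_one : sm_pred cm_one;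
  sm_mul : forall x y, sm_pred x -> sm_pred y -> sm_pred (cm_mul x y)
}.

Definition full_submonoid (M : comm_monoid) : submonoid M :=
  @Submonoid M (fun=> True) I (fun _ _ _ _ => I).

Lemma submonoid_eqP (M : comm_monoid) (P Q : submonoid M) :
  (forall x, P x <-> Q x) -> P = Q.
Proof.
case: P Q => [P P1 PM] [Q Q1 QM] /= e.
have {}e : P = Q by apply: funext => x; exact/propext.
case: _ / e Q1 QM => Q1 QM.
by rewrite (Prop_irrelevance P1 Q1) (Prop_irrelevance PM QM).
Qed.

(* A commutative monoid up to an equivalence relation. *)
Record pre_monoid := PreMonoid {
  pm_sort : Type;
  pm_eq : pm_sort -> pm_sort -> Prop;
  pm_mul : pm_sort -> pm_sort -> pm_sort;
  pm_one : pm_sort;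
  pm_refl : forall x, pm_eq x x;
  pm_sym : forall x y, pm_eq x y -> pm_eq y x;
  pm_trans : forall x y z, pm_eq x y -> pm_eq y z -> pm_eq x z;
  pm_congr : forall x x' y y',
    pm_eq x x' -> pm_eq y y' -> pm_eq (pm_mul x y) (pm_mul x' y');
  pm_mulA : forall x y z,
    pm_eq (pm_mul (pm_mul x y) z) (pm_mul x (pm_mul y z));
  pm_mulC : forall x y, pm_eq (pm_mul x y) (pm_mul y x);
  pm_mul1 : forall x, pm_eq (pm_mul pm_one x) x
}.

Section Classes.
Variable T : pre_monoid.

Definition classes := {C : pm_sort T -> Prop | exists x, C = pm_eq x}.

Definition class (x : pm_sort T) : classes :=
  exist _ (pm_eq x) (ex_intro _ x erefl).

Definition class_repr (c : classes) : pm_sort T := sval (cid (svalP c)).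

Lemma classes_inj (c c' : classes) : sval c = sval c' -> c = c'.
Proof.
case: c c' => [C p] [C' p'] /= e; case: _ / e p' => p'.
by rewrite (Prop_irrelevance p p').
Qed.

Lemma class_reprK c : class (class_repr c) = c.
Proof. by apply: classes_inj; rewrite /class_repr; case: cid => x /= ->. Qed.

Lemma classP x y : class x = class y <-> pm_eq x y.
Proof.
split=> [[e]|h]; first by rewrite e; exact: pm_refl.
apply: classes_inj; apply: funext => z; apply: propext; split=> h'.
  exact: pm_trans (pm_sym h) h'.
exact: pm_trans h h'.
Qed.

Lemma class_ind (P : classes -> Prop) :
  (forall x, P (class x)) -> forall c, P c.
Proof. by move=> h c; rewrite -(class_reprK c). Qed.

Definition class_mul (c c' : classes) : classes :=
  class (pm_mul (class_repr c) (class_repr c')).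

Lemma class_mulE x y : class_mul (class x) (class y) = class (pm_mul x y).
Proof. by apply/classP/pm_congr; apply/classP; exact: class_reprK. Qed.

Lemma class_mulA : associative class_mul.
Proof.
elim/class_ind=> x; elim/class_ind=> y; elim/class_ind=> z.
by rewrite !class_mulE; apply/classP/pm_sym/pm_mulA.
Qed.

Lemma class_mulC : commutative class_mul.
Proof.
elim/class_ind=> x; elim/class_ind=> y.
by rewrite !class_mulE; apply/classP/pm_mulC.
Qed.

Lemma class_mul1 : left_id (class (pm_one T)) class_mul.
Proof. by elim/class_ind=> x; rewrite class_mulE; apply/classP/pm_mul1. Qed.

Definition class_monoid : comm_monoid :=
  CommMonoid class_mulA class_mulC class_mul1.

End Classes.

Section MonoidQuotient.
Variables (M : comm_monoid) (N : submonoid M).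
Local Notation "x * y" := (cm_mul x y).
Local Notation "1" := cm_one.

Definition quot_rel (m1 m2 : M) : Prop :=
  exists n1 n2, [/\ N n1, N n2 & m1 * n1 = m2 * n2].

Lemma cm_mulAC (x y z : M) : x * y * z = x * z * y.
Proof. by rewrite -!cm_mulA (cm_mulC y). Qed.

Lemma cm_mulACA (x y z t : M) : (x * y) * (z * t) = (x * z) * (y * t).
Proof. by rewrite !cm_mulA (cm_mulAC x y). Qed.

Lemma quot_rel_refl x : quot_rel x x.
Proof. by exists 1, 1; split=> //; exact: sm_one. Qed.

Lemma quot_rel_sym x y : quot_rel x y -> quot_rel y x.
Proof. by move=> [n1 [n2 [h1 h2 e]]]; exists n2, n1. Qed.

Lemma quot_rel_trans x y z : quot_rel x y -> quot_rel y z -> quot_rel x z.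
Proof.
move=> [n1 [n2 [h1 h2 e]]] [n3 [n4 [h3 h4 e']]].
exists (n1 * n3), (n4 * n2); split; try exact: sm_mul.
by rewrite cm_mulA e cm_mulAC e' cm_mulA.
Qed.

Lemma quot_rel_congr x x' y y' :
  quot_rel x x' -> quot_rel y y' -> quot_rel (x * y) (x' * y').
Proof.
move=> [n1 [n2 [h1 h2 e]]] [n3 [n4 [h3 h4 e']]].
exists (n1 * n3), (n2 * n4); split; try exact: sm_mul.
by rewrite cm_mulACA e e' cm_mulACA.
Qed.

Lemma quot_rel_mulA x y z : quot_rel ((x * y) * z) (x * (y * z)).
Proof. by rewrite cm_mulA; exact: quot_rel_refl. Qed.

Lemma quot_rel_mulC x y : quot_rel (x * y) (y * x).
Proof. by rewrite cm_mulC; exact: quot_rel_refl. Qed.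

Lemma quot_rel_mul1 x : quot_rel (1 * x) x.
Proof. by rewrite cm_mul1; exact: quot_rel_refl. Qed.

Definition quot_pre : pre_monoid := PreMonoid quot_rel_refl quot_rel_sym
  quot_rel_trans quot_rel_congr quot_rel_mulA quot_rel_mulC quot_rel_mul1.

Definition monoid_quot : comm_monoid := class_monoid quot_pre.

Definition quot_class (m : M) : monoid_quot := @class quot_pre m.

Variable Q : submonoid M.

Definition sub_quot_pred (x : monoid_quot) : Prop :=
  exists2 m, Q m & x = quot_class m.

Lemma sub_quot1 : sub_quot_pred cm_one.
Proof. by exists 1; first exact: sm_one. Qed.

Lemma sub_quotM x y :
  sub_quot_pred x -> sub_quot_pred y -> sub_quot_pred (cm_mul x y).
Proof.
move=> [m hm ->] [n hn ->]; exists (m * n); first exact: sm_mul.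
exact: (@class_mulE quot_pre).
Qed.

(* When N is contained in Q, this is the image of the injection of Q / N into
   M / N. *)
Definition sub_quot : submonoid monoid_quot := Submonoid sub_quot1 sub_quotM.

End MonoidQuotient.

(* The library's algType forces the base ring and the algebra to be nontrivial,
   which excludes R = 0 and most tensor products; so an R-algebra is a ring
   with a ring morphism from R to its centre. *)
Record algebra (R : comPzRingType) := Algebra {
  alg_sort :> pzRingType;
  alg_in : {rmorphism R -> alg_sort};
  alg_inC : forall r x, alg_in r * x = x * alg_in r
}.

Arguments alg_in {R} a : rename.

Section Tensor.
Variables (R : comPzRingType) (A B : algebra R).

Definition balanced (V : zmodType) (f : A -> B -> V) : Prop :=
  [/\ forall a a' b, f (a + a') b = f a b + f a' b,
      forall a b b', f a (b + b') = f a b + f a b'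
    & forall a r b, f (a * alg_in A r) b = f a (alg_in B r * b)].

Definition tens_eval (V : zmodType) (f : A -> B -> V) (s : seq (A * B)) : V :=
  \sum_(p <- s) f p.1 p.2.

(* A sequence stands for the sum of the pure tensors of its entries; two sums
   are identified when no balanced map separates them. *)
Definition tens_rel : rel (seq (A * B)) := fun s t =>
  `[< forall (V : zmodType) (f : A -> B -> V), balanced f ->
        tens_eval f s = tens_eval f t >].

Lemma tens_rel_refl : reflexive tens_rel.
Proof. by move=> s; apply/asboolP. Qed.

Lemma tens_rel_sym : symmetric tens_rel.
Proof. by move=> s t; apply/asboolP/asboolP => h V f /h. Qed.

Lemma tens_rel_trans : transitive tens_rel.
Proof.
move=> t s u /asboolP h /asboolP h'; apply/asboolP => V f bf.
by rewrite h // h'.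
Qed.

Canonical tens_equiv :=
  EquivRel tens_rel tens_rel_refl tens_rel_sym tens_rel_trans.

Definition tens := {eq_quot tens_rel}.
HB.instance Definition _ := Choice.on tens.

Definition tens_class (s : seq (A * B)) : tens := \pi_({eq_quot tens_rel}) s.

Lemma tens_classP s t : tens_class s = tens_class t <-> tens_rel s t.
Proof. by split=> [/eqquotP|h] //; apply/eqquotP. Qed.

Lemma tens_classK t : tens_class (repr t) = t.
Proof. exact: reprK. Qed.

Definition pure (a : A) (b : B) : tens := tens_class [:: (a, b)].

Definition lift (V : zmodType) (f : A -> B -> V) (t : tens) : V :=
  tens_eval f (repr t).

Lemma lift_class (V : zmodType) (f : A -> B -> V) s :
  balanced f -> lift f (tens_class s) = tens_eval f s.
Proof.
have /tens_classP/asboolP := tens_classK (tens_class s).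
exact.
Qed.

Lemma tens_eval_cat (V : zmodType) (f : A -> B -> V) s t :
  tens_eval f (s ++ t) = tens_eval f s + tens_eval f t.
Proof. by rewrite /tens_eval big_cat. Qed.

Lemma tens_eval1 (V : zmodType) (f : A -> B -> V) a b :
  tens_eval f [:: (a, b)] = f a b.
Proof. by rewrite /tens_eval big_seq1. Qed.

Lemma lift_pure (V : zmodType) (f : A -> B -> V) a b :
  balanced f -> lift f (pure a b) = f a b.
Proof. by move=> bf; rewrite /pure lift_class // tens_eval1. Qed.

Lemma balanced0l (V : zmodType) (f : A -> B -> V) b : balanced f -> f 0 b = 0.
Proof.
by case=> h _ _; apply: (addrI (f 0 b)); rewrite -h !addr0.
Qed.

Lemma balanced0r (V : zmodType) (f : A -> B -> V) a : balanced f -> f a 0 = 0.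
Proof.
by case=> _ h _; apply: (addrI (f a 0)); rewrite -h !addr0.
Qed.

Definition tens_zero : tens := tens_class [::].
Definition tens_opp (x : tens) : tens :=
  tens_class [seq (- p.1, p.2) | p <- repr x].
Definition tens_add (x y : tens) : tens := tens_class (repr x ++ repr y).

Lemma tens_lift_inj (x y : tens) :
  (forall (V : zmodType) (f : A -> B -> V), balanced f -> lift f x = lift f y) ->
  x = y.
Proof.
move=> h; rewrite -(tens_classK x) -(tens_classK y).
by apply/tens_classP/asboolP.
Qed.

Lemma lift_add_subproof (V : zmodType) (f : A -> B -> V) x y :
  balanced f -> lift f (tens_add x y) = lift f x + lift f y.
Proof. by move=> bf; rewrite lift_class // tens_eval_cat. Qed.

Lemma lift_zero_subproof (V : zmodType) (f : A -> B -> V) :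
  balanced f -> lift f tens_zero = 0.
Proof. by move=> bf; rewrite lift_class // /tens_eval big_nil. Qed.

Lemma lift_opp_subproof (V : zmodType) (f : A -> B -> V) x :
  balanced f -> lift f (tens_opp x) = - lift f x.
Proof.
move=> bf; rewrite lift_class // /lift /tens_eval big_map -sumrN.
apply: eq_bigr => p _ /=; apply: (addrI (f p.1 p.2)); rewrite subrr.
by case: (bf) => h _ _; rewrite -h subrr balanced0l.
Qed.

Lemma tens_addA : associative tens_add.
Proof.
move=> x y z; apply: tens_lift_inj => V f bf.
by rewrite !lift_add_subproof // addrA.
Qed.

Lemma tens_addC : commutative tens_add.
Proof.
move=> x y; apply: tens_lift_inj => V f bf.
by rewrite !lift_add_subproof // addrC.
Qed.

Lemma tens_add0 : left_id tens_zero tens_add.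
Proof.
move=> x; apply: tens_lift_inj => V f bf.
by rewrite lift_add_subproof // lift_zero_subproof // add0r.
Qed.

Lemma tens_addN : left_inverse tens_zero tens_opp tens_add.
Proof.
move=> x; apply: tens_lift_inj => V f bf.
by rewrite lift_add_subproof // lift_zero_subproof // lift_opp_subproof // addNr.
Qed.

HB.instance Definition _ :=
  GRing.isZmodule.Build tens tens_addA tens_addC tens_add0 tens_addN.

Lemma liftD (V : zmodType) (f : A -> B -> V) :
  balanced f -> {morph lift f : x y / x + y}.
Proof. by move=> bf x y; exact: lift_add_subproof. Qed.

Lemma lift0 (V : zmodType) (f : A -> B -> V) : balanced f -> lift f 0 = 0.
Proof. by move=> bf; exact: lift_zero_subproof. Qed.

Lemma pure_balanced : balanced pure.
Proof.
split=> *; apply: tens_lift_inj => V f bf; rewrite ?liftD ?lift_pure //;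
  by case: bf.
Qed.

Lemma pureDl a a' b : pure (a + a') b = pure a b + pure a' b.
Proof. by case: pure_balanced. Qed.

Lemma pureDr a b b' : pure a (b + b') = pure a b + pure a b'.
Proof. by case: pure_balanced. Qed.

Lemma pure_in a r b : pure (a * alg_in A r) b = pure a (alg_in B r * b).
Proof. by case: pure_balanced. Qed.

Lemma pure0l b : pure 0 b = 0.
Proof. by apply: balanced0l pure_balanced. Qed.

Lemma pure_suml (I : Type) (r : seq I) (P : pred I) (F : I -> A) b :
  pure (\sum_(i <- r | P i) F i) b = \sum_(i <- r | P i) pure (F i) b.
Proof.
apply: (big_morph (fun a => pure a b)); last exact: pure0l.
by move=> x y; exact: pureDl.
Qed.

Lemma pure_sumr (I : Type) (r : seq I) (P : pred I) (F : I -> B) a :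
  pure a (\sum_(i <- r | P i) F i) = \sum_(i <- r | P i) pure a (F i).
Proof.
apply: (big_morph (pure a)); first by move=> x y; exact: pureDr.
by apply: balanced0r pure_balanced.
Qed.

Lemma tens_ind (P : tens -> Prop) :
  (forall a b, P (pure a b)) -> (forall x y, P x -> P y -> P (x + y)) ->
  forall x, P x.
Proof.
move=> h1 hD x; rewrite -(tens_classK x); elim: (repr x) => [|[a b] s IHs].
  have -> : tens_class [::] = pure 0 0; last exact: h1.
  by rewrite pure0l.
have -> : tens_class ((a, b) :: s) = pure a b + tens_class s.
  apply: tens_lift_inj => V f bf; rewrite liftD // lift_pure //.
  by rewrite !lift_class // /tens_eval big_cons.
exact: hD.
Qed.

Lemma lift_add (V : zmodType) (f g : A -> B -> V) x :
  lift (fun a b => f a b + g a b) x = lift f x + lift g x.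
Proof. exact: big_split. Qed.

Lemma eq_lift (V : zmodType) (f g : A -> B -> V) x :
  (forall a b, f a b = g a b) -> lift f x = lift g x.
Proof. by move=> h; apply: eq_bigr => p _. Qed.

Definition tens_mul (x y : tens) : tens :=
  lift (fun a b => lift (fun a' b' => pure (a * a') (b * b')) y) x.

Lemma mul_balanced a b : balanced (fun a' b' => pure (a * a') (b * b')).
Proof.
split=> [a1 a2 b1|a1 b1 b2|a1 r b1].
- by rewrite mulrDr pureDl.
- by rewrite mulrDr pureDr.
by rewrite mulrA pure_in !mulrA alg_inC.
Qed.

Lemma mul_balanced' y :
  balanced (fun a b => lift (fun a' b' => pure (a * a') (b * b')) y).
Proof.
split=> [a1 a2 b1|a1 b1 b2|a1 r b1].
- by rewrite -lift_add; apply: eq_lift => a b; rewrite mulrDl pureDl.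
- by rewrite -lift_add; apply: eq_lift => a b; rewrite mulrDl pureDr.
apply: eq_lift => a b.
by rewrite -mulrA alg_inC mulrA pure_in mulrA.
Qed.

Lemma tens_mul_pure a b a' b' :
  tens_mul (pure a b) (pure a' b') = pure (a * a') (b * b').
Proof.
rewrite /tens_mul lift_pure; last exact: mul_balanced'.
by rewrite lift_pure //; exact: mul_balanced.
Qed.

Lemma tens_mulDl : left_distributive tens_mul +%R.
Proof. by move=> x y z; apply: liftD; exact: mul_balanced'. Qed.

Lemma tens_mulDr : right_distributive tens_mul +%R.
Proof.
move=> x y z; rewrite /tens_mul -lift_add; apply: eq_lift => a b.
by apply: liftD; exact: mul_balanced.
Qed.

Lemma tens_mulA : associative tens_mul.
Proof.
move=> x y z; elim/tens_ind: x => [a b|x x' ex ex'].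
  elim/tens_ind: y => [a' b'|y y' ey ey'].
    elim/tens_ind: z => [a'' b''|z z' ez ez'].
      by rewrite !tens_mul_pure !mulrA.
    by rewrite !tens_mulDr ez ez'.
  by rewrite !(tens_mulDl, tens_mulDr) ey ey'.
by rewrite !tens_mulDl ex ex'.
Qed.

Lemma tens_mul1 : left_id (pure 1 1) tens_mul.
Proof.
elim/tens_ind=> [a b|x y ex ey]; first by rewrite tens_mul_pure !mul1r.
by rewrite tens_mulDr ex ey.
Qed.

Lemma tens_1mul : right_id (pure 1 1) tens_mul.
Proof.
elim/tens_ind=> [a b|x y ex ey]; first by rewrite tens_mul_pure !mulr1.
by rewrite tens_mulDl ex ey.
Qed.

HB.instance Definition _ := GRing.Zmodule_isPzRing.Build tens
  tens_mulA tens_mul1 tens_1mul tens_mulDl tens_mulDr.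

Lemma pureM a b a' b' : pure a b * pure a' b' = pure (a * a') (b * b').
Proof. exact: tens_mul_pure. Qed.

Lemma pure11 : pure 1 1 = 1. Proof. by []. Qed.

Definition tens_in (r : R) : tens := pure (alg_in A r) 1.

Lemma tens_in_additive : nmod_morphism tens_in.
Proof.
by split=> [|r s]; rewrite /tens_in; [rewrite rmorph0 pure0l|rewrite rmorphD pureDl].
Qed.

Lemma tens_in_multiplicative : GRing.monoid_morphism tens_in.
Proof.
split=> [|r s]; rewrite /tens_in; first by rewrite rmorph1.
by rewrite pureM rmorphM mulr1.
Qed.

HB.instance Definition _ :=
  GRing.isNmodMorphism.Build R tens tens_in tens_in_additive.
HB.instance Definition _ :=
  GRing.isMonoidMorphism.Build R tens tens_in tens_in_multiplicative.

Lemma tens_inC r x : tens_in r * x = x * tens_in r.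
Proof.
elim/tens_ind: x => [a b|x y ex ey]; last by rewrite mulrDl mulrDr ex ey.
by rewrite !pureM mul1r mulr1 alg_inC.
Qed.

Definition tens_alg : algebra R := Algebra tens_inC.

Lemma tens_inr r : tens_in r = pure 1 (alg_in B r).
Proof. by rewrite /tens_in -[X in pure X _]mul1r pure_in mulr1. Qed.

End Tensor.

Notation "A ⊗ B" := (tens_alg A B) (at level 40, left associativity).

Section TensorExt.
Variables (R : comPzRingType) (A B : algebra R).

Lemma tens_ext (V : zmodType) (f g : A ⊗ B -> V) :
  {morph f : x y / x + y} -> {morph g : x y / x + y} ->
  (forall a b, f (pure a b) = g (pure a b)) -> forall x, f x = g x.
Proof. by move=> fD gD h; elim/tens_ind=> // x y ex ey; rewrite fD gD ex ey. Qed.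

Lemma tens_mul_ext (S : pzRingType) (f : A ⊗ B -> S) :
  {morph f : x y / x + y} ->
  (forall a b a' b', f (pure a b * pure a' b') = f (pure a b) * f (pure a' b')) ->
  {morph f : x y / x * y}.
Proof.
move=> fD h x y; elim/tens_ind: x => [a b|x x' ex ex'].
  elim/tens_ind: y => [a' b'|y y' ey ey']; first exact: h.
  by rewrite mulrDr !fD ey ey' mulrDr.
by rewrite mulrDl !fD ex ex' mulrDl.
Qed.

End TensorExt.

Definition alg_iso (R : comPzRingType) (A B : algebra R) : Prop :=
  exists2 f : {rmorphism A -> B},
    bijective f & forall r, f (alg_in A r) = alg_in B r.

Section IsoTheory.
Variable R : comPzRingType.
Implicit Types A B C : algebra R.

Definition is_iso A B (f : A -> B) : Prop :=
  [/\ {morph f : x y / x + y}, {morph f : x y / x * y},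
      forall r, f (alg_in A r) = alg_in B r & bijective f].

Lemma is_iso_rmorphism A B (f : A -> B) : is_iso f ->
  exists g : {rmorphism A -> B}, g = f :> (A -> B).
Proof.
move=> [fD fM fi _].
have fN : nmod_morphism f.
  by split=> //; apply: (addrI (f 0)); rewrite -fD !addr0.
have fM1 : GRing.monoid_morphism f.
  by split=> //; rewrite -(rmorph1 (alg_in A)) fi rmorph1.
pose af := GRing.isNmodMorphism.Build A B f fN.
pose mf := GRing.isMonoidMorphism.Build A B f fM1.
pose F : {rmorphism A -> B} := HB.pack f af mf.
by exists F.
Qed.

Lemma alg_isoP A B : alg_iso A B <-> exists f : A -> B, is_iso f.
Proof.
split=> [[f bf fi]|[f hf]].
  by exists f; split=> //; [exact: rmorphD|exact: rmorphM].
have [g e] := is_iso_rmorphism hf; case: hf => _ _ fi bf.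
by exists g; rewrite e.
Qed.

Lemma is_iso_id A : is_iso (@id A).
Proof. by split=> //; exists id. Qed.

Lemma is_iso_comp A B C (f : A -> B) (g : B -> C) :
  is_iso f -> is_iso g -> is_iso (g \o f).
Proof.
move=> [f1 f2 f3 f4] [g1 g2 g3 g4]; split=> [x y|x y|r|] /=.
- by rewrite f1 g1.
- by rewrite f2 g2.
- by rewrite f3 g3.
exact: bij_comp.
Qed.

Lemma is_iso_inv A B (f : A -> B) : is_iso f ->
  exists g : B -> A, [/\ is_iso g, cancel f g & cancel g f].
Proof.
move=> [f1 f2 f3 [g fK gK]]; exists g; split=> //; split=> [x y|x y|r|].
- by apply: (can_inj fK); rewrite f1 !gK.
- by apply: (can_inj fK); rewrite f2 !gK.
- by apply: (can_inj fK); rewrite f3 !gK.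
by exists f.
Qed.

Definition tens_map A A' B B' (f : A -> A') (g : B -> B') : A ⊗ B -> A' ⊗ B' :=
  lift (fun a b => pure (f a) (g b)).

Lemma tens_map_balanced A A' B B' (f : A -> A') (g : B -> B') :
  is_iso f -> is_iso g -> balanced (fun a b => pure (f a) (g b)).
Proof.
move=> [f1 f2 f3 _] [g1 g2 g3 _]; split=> [a a' b|a b b'|a r b].
- by rewrite f1 pureDl.
- by rewrite g1 pureDr.
by rewrite f2 g2 f3 g3 pure_in.
Qed.

Lemma tens_map_pure A A' B B' (f : A -> A') (g : B -> B') a b :
  is_iso f -> is_iso g -> tens_map f g (pure a b) = pure (f a) (g b).
Proof. by move=> hf hg; rewrite /tens_map lift_pure //; exact: tens_map_balanced. Qed.

Lemma tens_map_iso A A' B B' (f : A -> A') (g : B -> B') :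
  is_iso f -> is_iso g -> is_iso (tens_map f g).
Proof.
move=> hf hg.
have [f' [hf' fK fK']] := is_iso_inv hf.
have [g' [hg' gK gK']] := is_iso_inv hg.
have D1 : {morph tens_map f g : x y / x + y}.
  by apply: liftD; exact: tens_map_balanced.
have D2 : {morph tens_map f' g' : x y / x + y}.
  by apply: liftD; exact: tens_map_balanced.
case: (hf) (hg) => [_ f2 f3 _] [_ g2 g3 _].
split=> //.
- apply: tens_mul_ext => // a b a' b'.
  by rewrite pureM !tens_map_pure // pureM f2 g2.
- by move=> r; rewrite tens_map_pure // f3 -(rmorph1 (alg_in B)) g3 !rmorph1.
exists (tens_map f' g').
  apply: tens_ext => // [x y|a b]; first by rewrite D1 D2.
  by rewrite !tens_map_pure // fK gK.
apply: tens_ext => // [x y|a b]; first by rewrite D2 D1.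
by rewrite !tens_map_pure // fK' gK'.
Qed.

Definition tens_swap A B : A ⊗ B -> B ⊗ A := lift (fun a b => pure b a).

Lemma tens_swap_balanced A B : balanced (fun (a : A) (b : B) => pure b a).
Proof.
split=> [a a' b|a b b'|a r b]; rewrite ?pureDl ?pureDr //.
by rewrite -!alg_inC !alg_inC pure_in alg_inC.
Qed.

Lemma tens_swap_pure A B (a : A) (b : B) : tens_swap (pure a b) = pure b a.
Proof. by rewrite /tens_swap lift_pure //; exact: tens_swap_balanced. Qed.

Lemma tens_swapD A B : {morph @tens_swap A B : x y / x + y}.
Proof. by apply: liftD; exact: tens_swap_balanced. Qed.

Lemma tens_swapK A B : cancel (@tens_swap A B) (@tens_swap B A).
Proof.
apply: tens_ext => // [x y|a b]; first by rewrite !tens_swapD.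
by rewrite !tens_swap_pure.
Qed.

Lemma tens_swap_iso A B : is_iso (@tens_swap A B).
Proof.
split; first exact: tens_swapD.
- apply: tens_mul_ext => [|a b a' b']; first exact: tens_swapD.
  by rewrite pureM !tens_swap_pure pureM.
- by move=> r; rewrite tens_swap_pure /= tens_inr.
by exists (@tens_swap B A); exact: tens_swapK.
Qed.

Section Assoc.
Variables A B C : algebra R.

Definition tens_assoc : (A ⊗ B) ⊗ C -> A ⊗ (B ⊗ C) :=
  lift (fun (x : A ⊗ B) c => lift (fun a b => pure a (pure b c : B ⊗ C)) x).

Definition tens_assoc' : A ⊗ (B ⊗ C) -> (A ⊗ B) ⊗ C :=
  lift (fun a (x : B ⊗ C) => lift (fun b c => pure (pure a b : A ⊗ B) c) x).

Lemma assoc_balanced1 c :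
  balanced (fun a b => pure a (pure b c : B ⊗ C) : A ⊗ (B ⊗ C)).
Proof.
split=> [a a' b|a b b'|a r b]; rewrite ?pureDl ?pureDr //.
by rewrite pure_in /= pureM mul1r.
Qed.

Lemma assoc_balanced2 : balanced
  (fun (x : A ⊗ B) c =>
     lift (fun a b => pure a (pure b c : B ⊗ C) : A ⊗ (B ⊗ C)) x).
Proof.
split=> [x y c|x c c'|x r c].
- by apply: liftD; exact: assoc_balanced1.
- by rewrite -lift_add; apply: eq_lift => a b; rewrite !pureDr.
elim/tens_ind: x => [a b|x y ex ey].
  rewrite pureM mulr1 !lift_pure; try exact: assoc_balanced1.
  rewrite pure_in; congr pure.
  by rewrite /= tens_inr pureM mul1r.
rewrite mulrDl !liftD; try exact: assoc_balanced1.
by rewrite ex ey.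
Qed.

Lemma assoc_balanced1' a :
  balanced (fun b c => pure (pure a b : A ⊗ B) c : (A ⊗ B) ⊗ C).
Proof.
split=> [b b' c|b c c'|b r c]; rewrite ?pureDr ?pureDl //.
by rewrite -pure_in /= tens_inr pureM mulr1.
Qed.

Lemma assoc_balanced2' : balanced
  (fun a (x : B ⊗ C) =>
     lift (fun b c => pure (pure a b : A ⊗ B) c : (A ⊗ B) ⊗ C) x).
Proof.
split=> [a a' x|a x y|a r x].
- by rewrite -lift_add; apply: eq_lift => b c; rewrite !pureDl.
- by apply: liftD; exact: assoc_balanced1'.
elim/tens_ind: x => [b c|x y ex ey].
  rewrite pureM mul1r !lift_pure; try exact: assoc_balanced1'.
  by rewrite pure_in.
rewrite mulrDr !liftD; try exact: assoc_balanced1'.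
by rewrite ex ey.
Qed.

Lemma tens_assoc_pure a b c :
  tens_assoc (pure (pure a b : A ⊗ B) c) = pure a (pure b c : B ⊗ C).
Proof.
rewrite /tens_assoc lift_pure; last exact: assoc_balanced2.
by rewrite lift_pure //; exact: assoc_balanced1.
Qed.

Lemma tens_assoc'_pure a b c :
  tens_assoc' (pure a (pure b c : B ⊗ C)) = pure (pure a b : A ⊗ B) c.
Proof.
rewrite /tens_assoc' lift_pure; last exact: assoc_balanced2'.
by rewrite lift_pure //; exact: assoc_balanced1'.
Qed.

Lemma tens_assocD : {morph tens_assoc : x y / x + y}.
Proof. by apply: liftD; exact: assoc_balanced2. Qed.

Lemma tens_assoc'D : {morph tens_assoc' : x y / x + y}.
Proof. by apply: liftD; exact: assoc_balanced2'. Qed.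

Lemma tens_ext3 (V : zmodType) (f g : (A ⊗ B) ⊗ C -> V) :
  {morph f : x y / x + y} -> {morph g : x y / x + y} ->
  (forall a b c, f (pure (pure a b : A ⊗ B) c) = g (pure (pure a b : A ⊗ B) c)) ->
  forall x, f x = g x.
Proof.
move=> fD gD h; apply: tens_ext => // x c.
elim/tens_ind: x => [a b|x y ex ey]; first exact: h.
by rewrite pureDl fD gD ex ey.
Qed.

Lemma tens_assoc_iso : is_iso tens_assoc.
Proof.
split; first exact: tens_assocD.
- apply: tens_mul_ext => [|x c y c']; first exact: tens_assocD.
  elim/tens_ind: x => [a b|x x' ex ex']; last first.
    by rewrite pureDl mulrDl !tens_assocD mulrDl ex ex'.
  elim/tens_ind: y => [a' b'|y y' ey ey']; last first.
    by rewrite pureDl mulrDr !tens_assocD mulrDr ey ey'.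
  by rewrite !pureM !tens_assoc_pure !pureM.
- by move=> r; rewrite /= /tens_in /= tens_assoc_pure.
exists tens_assoc'.
  apply: tens_ext3 => // [x y|a b c]; first by rewrite tens_assocD tens_assoc'D.
  by rewrite tens_assoc_pure tens_assoc'_pure.
apply: tens_ext => // [x y|a x]; first by rewrite tens_assoc'D tens_assocD.
elim/tens_ind: x => [b c|x y ex ey].
  by rewrite tens_assoc'_pure tens_assoc_pure.
by rewrite pureDr tens_assoc'D tens_assocD ex ey.
Qed.

End Assoc.

Lemma self_alg_inC (r x : R) : (idfun : {rmorphism R -> R}) r * x = x * idfun r.
Proof. exact: mulrC. Qed.

Definition self_alg : algebra R := Algebra self_alg_inC.

Definition tens_unit A : self_alg ⊗ A -> A :=
  lift (fun (r : self_alg) a => alg_in A r * a).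

Lemma tens_unit_balanced A : balanced (fun (r : self_alg) a => alg_in A r * a).
Proof.
split=> [r s a|r a b|r s a].
- by rewrite rmorphD mulrDl.
- by rewrite mulrDr.
by rewrite rmorphM mulrA.
Qed.

Lemma tens_unit_pure A (r : self_alg) a :
  tens_unit (pure r a : self_alg ⊗ A) = alg_in A r * a.
Proof. by rewrite /tens_unit lift_pure //; exact: tens_unit_balanced. Qed.

Lemma tens_unitD A : {morph @tens_unit A : x y / x + y}.
Proof. by apply: liftD; exact: tens_unit_balanced. Qed.

Lemma tens_unit_iso A : is_iso (@tens_unit A).
Proof.
split; first exact: tens_unitD.
- apply: tens_mul_ext => [|r a s b]; first exact: tens_unitD.
  rewrite pureM !tens_unit_pure rmorphM -!mulrA; congr (_ * _).
  by rewrite !mulrA alg_inC.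
- by move=> r; rewrite tens_unit_pure mulr1.
exists (fun a => pure (1 : self_alg) a : self_alg ⊗ A).
  apply: tens_ext => // [x y|r a]; first by rewrite tens_unitD pureDr.
  by rewrite tens_unit_pure -pure_in mul1r.
by move=> a; rewrite tens_unit_pure rmorph1 mul1r.
Qed.

End IsoTheory.

Section Opposite.
Variables (R : comPzRingType) (A : algebra R).

Definition op_in (r : R) : A^c := alg_in A r.

Lemma op_in_additive : nmod_morphism op_in.
Proof. by split=> [|r s]; rewrite /op_in ?rmorph0 ?rmorphD. Qed.

Lemma op_in_multiplicative : GRing.monoid_morphism op_in.
Proof.
by split=> [|r s]; rewrite /op_in ?rmorph1 // mulrC rmorphM.
Qed.

HB.instance Definition _ :=
  GRing.isNmodMorphism.Build R A^c op_in op_in_additive.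
HB.instance Definition _ :=
  GRing.isMonoidMorphism.Build R A^c op_in op_in_multiplicative.

Lemma op_inC r (x : A^c) : op_in r * x = x * op_in r.
Proof. by apply: esym; exact: (alg_inC r (x : A)). Qed.

Definition op_alg : algebra R := Algebra op_inC.

Definition mult_map : A ⊗ op_alg -> A :=
  lift (fun (a : A) (b : op_alg) => a * (b : A)).

(* The multiplication map of A splits as a map of left modules over the
   enveloping algebra A ⊗ A^op, in which a ⊗ b acts on A by x |-> a x b. *)
Definition separable : Prop := exists s : A -> A ⊗ op_alg,
  [/\ {morph s : x y / x + y},
      forall a (b : op_alg) x, s (a * x * (b : A)) = pure a b * s x
    & cancel s mult_map].

Definition central : Prop :=
  injective (alg_in A) /\
  forall x : A, (forall y, x * y = y * x) -> exists r, x = alg_in A r.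

Definition azumaya : Prop := central /\ separable.

End Opposite.

Section AzumayaTheory.
Variable R : comPzRingType.
Implicit Types A B : algebra R.

Lemma env_act_balanced A x :
  balanced (fun (a : A) (b : op_alg A) => a * x * (b : A)).
Proof.
split=> [a a' b|a b b'|a r b].
- by rewrite !mulrDl.
- by rewrite mulrDr.
have -> : (alg_in (op_alg A) r * b : op_alg A) = (b : A) * alg_in A r :> A by [].
by rewrite -(alg_inC r (b : A)) -[a * _ * x]mulrA alg_inC !mulrA.
Qed.

Definition env_act A (u : A ⊗ op_alg A) (x : A) : A :=
  lift (fun (a : A) (b : op_alg A) => a * x * (b : A)) u.

Lemma env_act_pure A (a : A) (b : op_alg A) x :
  env_act (pure a b) x = a * x * (b : A).
Proof. by rewrite /env_act lift_pure //; exact: env_act_balanced. Qed.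

Lemma env_actDl A x : {morph (fun u => @env_act A u x) : u v / u + v}.
Proof. by apply: liftD; exact: env_act_balanced. Qed.

Lemma env_actDr A (u : A ⊗ op_alg A) : {morph env_act u : x y / x + y}.
Proof.
move=> x y; rewrite -lift_add; apply: eq_lift => a b.
by rewrite mulrDr mulrDl.
Qed.

Lemma env_actM A (u v : A ⊗ op_alg A) x :
  env_act (u * v) x = env_act u (env_act v x).
Proof.
elim/tens_ind: u => [a b|u u' eu eu'].
  elim/tens_ind: v => [a' b'|v v' ev ev'].
    by rewrite pureM !env_act_pure !mulrA.
  by rewrite mulrDr !env_actDl env_actDr ev ev'.
by rewrite mulrDl !env_actDl eu eu'.
Qed.

Lemma env_act1_balanced A :
  balanced (fun (a : A) (b : op_alg A) => a * (b : A)).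
Proof.
by have [h1 h2 h3] := env_act_balanced (1 : A); split=> [a a' b|a b b'|a r b];
  [have := h1 a a' b | have := h2 a b b' | have := h3 a r b]; rewrite !mulr1.
Qed.

Lemma mult_mapE A (u : A ⊗ op_alg A) : mult_map u = env_act u 1.
Proof. by apply: eq_lift => a b; rewrite mulr1. Qed.

Lemma separableP A : separable A <-> exists e : A ⊗ op_alg A,
  mult_map e = 1 /\
  forall a : A, pure a 1 * e = pure 1 (a : op_alg A) * e.
Proof.
split=> [[s [sD sM sK]]|[e [e1 ec]]].
  exists (s 1); split=> [|a]; first exact: sK.
  have := sM 1 (a : op_alg A) 1; rewrite !mul1r => <-.
  by have := sM a (1 : op_alg A) 1; rewrite !mulr1 => <-.
exists (fun x => pure x 1 * e); split=> [x y|a b x|x].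
- by rewrite pureDl mulrDl.
- have -> : pure (a * x * (b : A)) 1 =
      pure (a * x) 1 * pure (b : A) 1 :> A ⊗ op_alg A.
    by rewrite pureM mulr1.
  by rewrite -mulrA ec !mulrA !pureM !mulr1 !mul1r.
by rewrite mult_mapE env_actM -mult_mapE e1 env_act_pure !mulr1.
Qed.

Lemma azumaya_proj A : azumaya A -> exists p : A -> R,
  [/\ {morph p : x y / x + y}, p 1 = 1,
      forall r x, p (alg_in A r * x) = r * p x
    & exists e : A ⊗ op_alg A,
        mult_map e = 1 /\ forall x, env_act e x = alg_in A (p x)].
Proof.
case=> -[inj cen] /separableP[e [e1 ec]].
have P x : exists r, env_act e x = alg_in A r.
  apply: cen => y.
  have := congr1 (fun u => env_act u x) (ec y).
  by rewrite !env_actM !env_act_pure mulr1 !mul1r => ->.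
have [p pP] := choice P; exists p; split=> [x y||r x|].
- by apply: inj; rewrite -pP env_actDr !pP rmorphD.
- by apply: inj; rewrite -pP -mult_mapE e1 rmorph1.
- apply: inj; rewrite -pP rmorphM -pP.
  elim/tens_ind: e {e1 ec P pP} => [a b|u v eu ev].
    rewrite !env_act_pure !mulrA; congr (_ * _ * _); exact/esym/alg_inC.
  by rewrite !env_actDl mulrDr eu ev.
by exists e.
Qed.

Lemma azumaya_center_l A B (t : A ⊗ B) : azumaya A ->
  (forall y, t * y = y * t) -> exists b, t = pure 1 b.
Proof.
case/azumaya_proj=> p [pD p1 pM [e [e1 ep]]] ct.
pose g (x : A) (b : B) := alg_in B (p x) * b.
have gb : balanced g.
  rewrite /g; split=> [a a' b|a b b'|a r b].
  - by rewrite pD rmorphD mulrDl.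
  - by rewrite mulrDr.
  by rewrite -(alg_inC r a) pM rmorphM mulrA alg_inC.
pose h x (a : A) (b : op_alg A) : A ⊗ B := pure a 1 * x * pure (b : A) 1.
have hb x : balanced (h x).
  rewrite /h; split=> [a a' b|a b b'|a r b].
  - by rewrite pureDl !mulrDl.
  - by rewrite pureDl mulrDr.
  have -> : pure (a * alg_in A r) 1 = pure a 1 * tens_in A B r.
    by rewrite pureM mulr1.
  have -> : pure ((alg_in (op_alg A) r * b : op_alg A) : A) 1 =
      tens_in A B r * pure (b : A) 1.
    by rewrite pureM mulr1; congr pure; exact/esym/alg_inC.
  by rewrite -!mulrA; congr (_ * _); rewrite !mulrA tens_inC.
have ht u : lift (h t) u = pure (mult_map u) 1 * t.
  elim/tens_ind: u => [a b|u v eu ev].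
    rewrite lift_pure // /h mult_mapE env_act_pure mulr1.
    by rewrite -mulrA ct mulrA pureM mulr1.
  by rewrite liftD // eu ev !mult_mapE env_actDl pureDl mulrDl.
have hp u a b : lift (h (pure a b)) u = pure (env_act u a) b.
  elim/tens_ind: u => [c d|u v eu ev].
    by rewrite lift_pure // /h env_act_pure !pureM mul1r mulr1.
  by rewrite liftD // eu ev env_actDl pureDl.
have hg x : lift (h x) e = pure 1 (lift g x).
  elim/tens_ind: x => [a b|x y ex ey].
    by rewrite hp ep lift_pure // /g -pure_in mul1r.
  rewrite [in RHS]liftD // pureDr -ex -ey -lift_add; apply: eq_lift => a b.
  by rewrite /h mulrDr mulrDl.
by exists (lift g t); rewrite -hg ht e1 mul1r.
Qed.

Lemma azumaya_tens A B : azumaya A -> azumaya B -> azumaya (A ⊗ B).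
Proof.
move=> azA azB; case: (azumaya_proj azA) => p [pD p1 pM _].
pose g (x : A) (b : B) := alg_in B (p x) * b.
have gb : balanced g.
  rewrite /g; split=> [a a' b|a b b'|a r b].
  - by rewrite pD rmorphD mulrDl.
  - by rewrite mulrDr.
  by rewrite -(alg_inC r a) pM rmorphM mulrA alg_inC.
case: (azA) (azB) => [[injA cA] sA] [[injB cB] sB].
split; first split=> [r s|t ct].
- move=> /(congr1 (lift g)); rewrite !lift_pure // /g !mulr1 => /injB.
  by rewrite -[alg_in A r]mulr1 -[alg_in A s]mulr1 !pM p1 !mulr1.
- have [b tb] := azumaya_center_l azA ct.
  have [_ mS _ _] := tens_swap_iso A B.
  have ct' y : tens_swap t * y = y * tens_swap t.
    by rewrite -(tens_swapK y) -!mS ct.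
  have [a ta] := azumaya_center_l azB ct'.
  have {}ta : t = pure a 1 by rewrite -(tens_swapK t) ta tens_swap_pure.
  exists (p a).
  have := congr1 (lift g) ta; rewrite {1}tb !lift_pure // /g p1 rmorph1 mul1r mulr1.
  by move=> eb; rewrite tb eb /= tens_inr.
apply/separableP.
have /separableP[e [e1 ec]] := sA; have /separableP[f [f1 fc]] := sB.
pose T := A ⊗ B.
pose th2 (a : A) (a' : op_alg A) (b : B) (b' : op_alg B) : T ⊗ op_alg T :=
  pure (pure a b : T) ((pure (a' : A) (b' : B) : T) : op_alg T).
have th2b a a' : balanced (th2 a a').
  rewrite /th2; split=> [b b1 b'|b b' b1|b r b'].
  - by rewrite pureDr pureDl.
  - by rewrite -pureDr; congr pure; exact: pureDr.
  have -> : pure a (b * alg_in B r) = (pure a b : T) * alg_in T r.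
    by rewrite /= tens_inr pureM mulr1.
  rewrite pure_in; congr pure.
  transitivity ((pure (a' : A) (b' : B) : T) * tens_in A B r); first by [].
  by rewrite tens_inr pureM mulr1.
pose th1 (v : B ⊗ op_alg B) (a : A) (a' : op_alg A) := lift (th2 a a') v.
have th1b v : balanced (th1 v).
  rewrite /th1; split=> [a a1 a'|a a' a1|a r a'].
  - by rewrite -lift_add; apply: eq_lift => b b'; rewrite /th2 !pureDl.
  - rewrite -lift_add; apply: eq_lift => b b'; rewrite /th2 -pureDr.
    by congr pure; exact: pureDl.
  apply: eq_lift => b b'; rewrite /th2.
  have -> : pure (a * alg_in A r) b = (pure a b : T) * alg_in T r.
    by rewrite /= pureM mulr1.
  rewrite pure_in; congr pure.
  transitivity ((pure (a' : A) (b' : B) : T) * tens_in A B r); first by [].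
  by rewrite pureM mulr1.
pose th u v := lift (th1 v) u.
have thDl v : {morph th^~ v : x y / x + y} by apply: liftD.
have thDr u : {morph th u : x y / x + y}.
  move=> x y; rewrite /th -lift_add; apply: eq_lift => a a'.
  by apply: liftD.
have thp a a' b b' : th (pure a a') (pure b b') = th2 a a' b b'.
  by rewrite /th lift_pure // /th1 lift_pure.
have thM u u' v v' : th u v * th u' v' = th (u * u') (v * v').
  elim/tens_ind: u => [a a'|u1 u2 h1 h2]; last by rewrite mulrDl !thDl mulrDl h1 h2.
  elim/tens_ind: u' => [c c'|u1 u2 h1 h2]; last by rewrite mulrDr !thDl mulrDr h1 h2.
  elim/tens_ind: v => [b b'|u1 u2 h1 h2]; last by rewrite mulrDl !thDr mulrDl h1 h2.
  elim/tens_ind: v' => [d d'|u1 u2 h1 h2]; last by rewrite mulrDr !thDr mulrDr h1 h2.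
  rewrite !pureM !thp /th2 pureM !pureM; congr pure.
  exact: pureM.
have thmu u v : mult_map (th u v) = pure (mult_map u) (mult_map v).
  rewrite !mult_mapE.
  elim/tens_ind: u => [a a'|u1 u2 h1 h2]; last by rewrite thDl !env_actDl pureDl h1 h2.
  elim/tens_ind: v => [b b'|u1 u2 h1 h2]; last by rewrite thDr !env_actDl pureDr h1 h2.
  by rewrite thp !env_act_pure !mulr1 pureM.
exists (th e f); split; first by rewrite thmu e1 f1.
elim/tens_ind=> [a b|x y ex ey]; last first.
  by rewrite pureDl mulrDl ex ey -mulrDl -pureDr.
have -> : pure (pure a b : T) (1 : op_alg T) = th (pure a 1) (pure b 1).
  by rewrite thp.
have -> : pure (1 : T) ((pure a b : T) : op_alg T) =
    th (pure 1 (a : op_alg A)) (pure 1 (b : op_alg B)) by rewrite thp.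
by rewrite !thM ec fc.
Qed.

Lemma azumaya_self : azumaya (self_alg R).
Proof.
split; first by split=> // x _; exists x.
apply/separableP; exists 1; split=> [|a].
  by rewrite mult_mapE -pure11 env_act_pure !mulr1.
rewrite !mulr1.
have /= := @pure_in R (self_alg R) (op_alg (self_alg R)) 1 a 1.
by rewrite mul1r mulr1.
Qed.

Lemma mx_alg_inC n (r : R) (x : 'M[R]_n) :
  (scalar_mx r : 'M[R]_n) * x = x * scalar_mx r.
Proof. exact/esym/scalar_mxC. Qed.

Definition mx_alg n : algebra R := @Algebra R 'M[R]_n (@scalar_mx R n) (@mx_alg_inC n).

Lemma azumaya_mx n : azumaya (mx_alg n.+1).
Proof.
have dE (x : 'M[R]_n.+1) (i j k l : 'I_n.+1) :
    (delta_mx i j *m x) k l = (k == i)%:R * x j l.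
  rewrite mxE (bigD1 j) //= big1 ?addr0 => [|m /negPf nm].
    by rewrite mxE eqxx andbT.
  by rewrite mxE nm andbF mul0r.
have dE' (x : 'M[R]_n.+1) (i j k l : 'I_n.+1) :
    (x *m delta_mx i j) k l = x k i * (l == j)%:R.
  rewrite mxE (bigD1 i) //= big1 ?addr0 => [|m /negPf nm].
    by rewrite mxE eqxx.
  by rewrite mxE nm mulr0.
split; first split.
- by move=> r s /matrixP/(_ ord0 ord0); rewrite !mxE eqxx !mulr1n.
- move=> x cx; exists ((x : 'M[R]_n.+1) ord0 ord0).
  apply/matrixP => i j; rewrite mxE.
  have := cx (delta_mx ord0 i : 'M[R]_n.+1) => /matrixP/(_ ord0 j).
  by rewrite [LHS]dE' [RHS]dE eqxx mul1r mulr_natr eq_sym.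
apply/separableP.
pose M := mx_alg n.+1.
pose E i j : M := (delta_mx i j : 'M[R]_n.+1).
exists (\sum_i pure (E i ord0) (E ord0 i : op_alg M)); split=> [|a].
  rewrite /mult_map (big_morph (lift _) (liftD (env_act1_balanced M))
    (lift0 (env_act1_balanced M))).
  rewrite [RHS](scalar_mx_sum_delta _ 1); apply: eq_bigr => i _.
  rewrite lift_pure; last exact: env_act1_balanced.
  by rewrite scale1r; exact: mul_delta_mx.
rewrite !mulr_sumr.
transitivity (\sum_i \sum_k
    pure (E k ord0) (alg_in (op_alg M) ((a : 'M[R]_n.+1) k i) * E ord0 i)).
  apply: eq_bigr => i _; rewrite pureM mul1r.
  have -> : a * E i ord0 =
      \sum_k E k ord0 * alg_in M ((a : 'M[R]_n.+1) k i).
    apply/matrixP => k l; rewrite [LHS]dE' summxE (bigD1 k) //= big1 => [|m nm].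
      by rewrite [X in _ = X + _]dE !mxE eqxx mul1r addr0 mulr_natr eq_sym.
    by rewrite [LHS]dE eq_sym (negPf nm) mul0r.
  by rewrite pure_suml; apply: eq_bigr => k _; rewrite pure_in.
rewrite exchange_big /=; apply: eq_bigr => k _; rewrite -pure_sumr pureM mul1r.
congr pure.
transitivity (\sum_i E ord0 i * alg_in M ((a : 'M[R]_n.+1) k i)); first by [].
transitivity (E ord0 k * a); last by [].
apply/matrixP => j l; rewrite [RHS]dE summxE (bigD1 l) //= big1 => [|m nm].
  by rewrite [X in X + _]dE !mxE eqxx addr0 mulr1n.
by rewrite [LHS]dE !mxE (negPf nm) mulr0n mulr0.
Qed.

End AzumayaTheory.

Section Kronecker.
Variables (R : comPzRingType) (n m : nat).

Definition idx_split (k : 'I_(n * m)) : 'I_n * 'I_m :=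
  enum_val (cast_ord (esym (mxvec_cast n m)) k).

Lemma idx_splitK k : mxvec_index (idx_split k).1 (idx_split k).2 = k.
Proof.
by rewrite /mxvec_index /idx_split -surjective_pairing enum_valK cast_ordKV.
Qed.

Lemma mxvec_indexK i j : idx_split (mxvec_index i j) = (i, j).
Proof. by rewrite /mxvec_index /idx_split cast_ordK enum_rankK. Qed.

Lemma idx_split_eq k l :
  (k == l) = ((idx_split k).1 == (idx_split l).1) &&
             ((idx_split k).2 == (idx_split l).2).
Proof.
apply/eqP/andP => [->//|[/eqP e1 /eqP e2]].
by rewrite -(idx_splitK k) -(idx_splitK l) e1 e2.
Qed.

Definition kron (X : 'M[R]_n) (Y : 'M[R]_m) : 'M[R]_(n * m) :=
  \matrix_(k, l) (X (idx_split k).1 (idx_split l).1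
                  * Y (idx_split k).2 (idx_split l).2).

Lemma sum_idx (V : nmodType) (F : 'I_(n * m) -> V) :
  \sum_k F k = \sum_i \sum_j F (mxvec_index i j).
Proof.
rewrite pair_bigA /= (reindex (fun p : 'I_n * 'I_m => mxvec_index p.1 p.2)) //=.
exists idx_split => [[i j]|k] _ /=; first by rewrite mxvec_indexK.
exact: idx_splitK.
Qed.

Lemma kronDl X X' Y : kron (X + X') Y = kron X Y + kron X' Y.
Proof. by apply/matrixP => k l; rewrite !mxE mulrDl. Qed.

Lemma kronDr X Y Y' : kron X (Y + Y') = kron X Y + kron X Y'.
Proof. by apply/matrixP => k l; rewrite !mxE mulrDr. Qed.

Lemma kronM X Y X' Y' : kron X Y *m kron X' Y' = kron (X *m X') (Y *m Y').
Proof.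
apply/matrixP => k l; rewrite !mxE sum_idx mulr_suml.
apply: eq_bigr => i _; rewrite mulr_sumr; apply: eq_bigr => j _.
by rewrite !mxE !mxvec_indexK /= mulrACA.
Qed.

Lemma kron_scalar r : kron r%:M 1%:M = r%:M.
Proof.
apply/matrixP => k l; rewrite !mxE idx_split_eq.
by do 2 case: eqP => _; rewrite ?mulr1n ?mulr0n ?mulr1 ?mulr0 ?mul0r.
Qed.

Let A := mx_alg R n.
Let B := mx_alg R m.
Let C := mx_alg R (n * m).

Lemma kron_balanced : balanced (kron : A -> B -> C).
Proof.
split=> [X X' Y|X Y Y'|X r Y]; [exact: kronDl|exact: kronDr|].
rewrite -[LHS]/(kron (X *m r%:M) Y) -[RHS]/(kron X (r%:M *m Y)).
rewrite scalar_mxC !mul_scalar_mx; apply/matrixP => k l.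
by rewrite !mxE mulrCA mulrA.
Qed.

Definition tens_kron : A ⊗ B -> C := lift (kron : A -> B -> C).

Lemma tens_kron_pure X Y : tens_kron (pure X Y) = kron X Y.
Proof. by rewrite /tens_kron lift_pure //; exact: kron_balanced. Qed.

Lemma tens_kronD : {morph tens_kron : x y / x + y}.
Proof. by apply: liftD; exact: kron_balanced. Qed.

Let EA (i j : 'I_n) : A := delta_mx i j.
Let EB (i j : 'I_m) : B := delta_mx i j.

Definition unkron (M : C) : A ⊗ B :=
  \sum_i \sum_j \sum_k \sum_l
    pure (alg_in A ((M : 'M_(n * m)) (mxvec_index i k) (mxvec_index j l))
            * EA i j) (EB k l).

Lemma unkronD : {morph unkron : x y / x + y}.
Proof.
move=> x y; rewrite /unkron; do 4 (rewrite -big_split; apply: eq_bigr => ? _ /=).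
by rewrite mxE rmorphD mulrDl pureDl.
Qed.

Lemma tens_kronK : cancel tens_kron unkron.
Proof.
apply: tens_ext => // [x y|X Y]; first by rewrite tens_kronD unkronD.
rewrite tens_kron_pure /unkron.
rewrite [in RHS](matrix_sum_delta X) pure_suml; apply: eq_bigr => i _.
rewrite pure_suml; apply: eq_bigr => j _.
rewrite [in RHS](matrix_sum_delta Y) pure_sumr; apply: eq_bigr => k _.
rewrite pure_sumr; apply: eq_bigr => l _.
rewrite mxE !mxvec_indexK /=.
have <- : alg_in A (X i j) * EA i j = X i j *: delta_mx i j.
  exact: mul_scalar_mx.
have <- : alg_in B (Y k l) * EB k l = Y k l *: delta_mx k l.
  exact: mul_scalar_mx.
rewrite -pure_in; congr pure.
by rewrite rmorphM -mulrA -mulrA; congr (_ * _); exact: alg_inC.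
Qed.

Lemma unkronK : cancel unkron tens_kron.
Proof.
move=> M; rewrite /unkron.
have kb := kron_balanced; have k0 := lift0 kb; have kD := liftD kb.
rewrite /tens_kron; apply/matrixP => u v.
rewrite -(idx_splitK u) -(idx_splitK v).
move: (idx_split u) (idx_split v) => [i k] [j l] /=.
pose ev (x : A ⊗ B) : R :=
  (lift (kron : A -> B -> C) x : 'M_(n * m)) (mxvec_index i k) (mxvec_index j l).
have ev0 : ev 0 = 0 by rewrite /ev k0 mxE.
have evD : {morph ev : x y / x + y} by move=> x y; rewrite /ev kD mxE.
rewrite -[LHS]/(ev _) (big_morph ev evD ev0) (bigD1 i) //=.
have evp a b c d x : ev (pure (alg_in A x * EA a b) (EB c d)) =
    x * ((i == a) && (j == b))%:R * ((k == c) && (l == d))%:R.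
  rewrite /ev lift_pure // mxE !mxvec_indexK /=.
  have -> : alg_in A x * EA a b = x *: delta_mx a b by exact: mul_scalar_mx.
  by rewrite !mxE.
rewrite [X in _ + X]big1 ?addr0 => [|a na]; last first.
  rewrite (big_morph ev evD ev0) big1 // => b _.
  rewrite (big_morph ev evD ev0) big1 // => c _.
  rewrite (big_morph ev evD ev0) big1 // => d _.
  by rewrite evp eq_sym (negPf na) mulr0 mul0r.
rewrite (big_morph ev evD ev0) (bigD1 j) //=.
rewrite [X in _ + X]big1 ?addr0 => [|b nb]; last first.
  rewrite (big_morph ev evD ev0) big1 // => c _.
  rewrite (big_morph ev evD ev0) big1 // => d _.
  by rewrite evp [j == b]eq_sym (negPf nb) andbF mulr0 mul0r.
rewrite (big_morph ev evD ev0) (bigD1 k) //=.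
rewrite [X in _ + X]big1 ?addr0 => [|c nc]; last first.
  rewrite (big_morph ev evD ev0) big1 // => d _.
  by rewrite evp [k == c]eq_sym (negPf nc) mulr0.
rewrite (big_morph ev evD ev0) (bigD1 l) //=.
rewrite [X in _ + X]big1 ?addr0 => [|d nd]; last first.
  by rewrite evp [l == d]eq_sym (negPf nd) andbF mulr0.
by rewrite evp !eqxx !mulr1.
Qed.

Lemma tens_kron_iso : is_iso tens_kron.
Proof.
split; first exact: tens_kronD.
- apply: tens_mul_ext => [|X Y X' Y']; first exact: tens_kronD.
  by rewrite pureM !tens_kron_pure; apply/esym; exact: kronM.
- by move=> r; rewrite tens_kron_pure; exact: kron_scalar.
by exists unkron; [exact: tens_kronK | exact: unkronK].
Qed.

End Kronecker.

Section ScalarMatrix.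
Variable R : comPzRingType.

Definition scalar1_mx (r : self_alg R) : mx_alg R 1 := scalar_mx r.

Lemma scalar1_mx_iso : is_iso scalar1_mx.
Proof.
split=> [r s|r s|r|] //; [exact: raddfD|exact: scalar_mxM|].
exists (fun x : mx_alg R 1 => (x : 'M_1) ord0 ord0) => [r|x].
  by rewrite mxE eqxx mulr1n.
exact/esym/mx11_scalar.
Qed.

End ScalarMatrix.

Record derivation (S : pzRingType) := Derivation {
  der_fun :> S -> S;
  derD : forall x y, der_fun (x + y) = der_fun x + der_fun y;
  derM : forall x y, der_fun (x * y) = der_fun x * y + x * der_fun y
}.

Record diff_algebra (R : comPzRingType) (d : derivation R) := DiffAlgebra {
  dalg :> algebra R;
  dalg_der : derivation dalg;
  dalg_der_in : forall r, dalg_der (alg_in dalg r) = alg_in dalg (d r)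
}.

Definition diff_iso (R : comPzRingType) (d : derivation R)
    (A B : diff_algebra d) : Prop :=
  exists f : {rmorphism A -> B},
    [/\ bijective f, forall r, f (alg_in A r) = alg_in B r
      & forall x, f (dalg_der A x) = dalg_der B (f x)].

Section DiffTheory.
Variables (R : comPzRingType) (d : derivation R).
Implicit Types A B C : diff_algebra d.

Lemma der0 (S : pzRingType) (D : derivation S) : D 0 = 0.
Proof. by apply: (addrI (D 0)); rewrite -derD !addr0. Qed.

Lemma der1 (S : pzRingType) (D : derivation S) : D 1 = 0.
Proof.
by apply: (addrI (D 1)); rewrite addr0 -{3}[1]mulr1 derM mulr1 mul1r.
Qed.

Lemma der_sum (S : pzRingType) (D : derivation S) (I : Type) (r : seq I)
    (F : I -> S) :
  D (\sum_(i <- r) F i) = \sum_(i <- r) D (F i).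
Proof. by apply: (big_morph D); [exact: derD | exact: der0]. Qed.

(* D_A ⊗ 1 and 1 ⊗ D_B are not well defined separately, the derivations not being
   R-linear; their sum is. *)
Definition tens_der_fun A B : A ⊗ B -> A ⊗ B :=
  lift (fun a b => pure (dalg_der A a) b + pure a (dalg_der B b)).

Lemma tens_der_balanced A B :
  balanced (fun a b => pure (dalg_der A a) b + pure a (dalg_der B b)).
Proof.
split=> [a a' b|a b b'|a r b].
- by rewrite derD !pureDl addrACA.
- by rewrite derD !pureDr addrACA.
rewrite !derM !dalg_der_in pureDl pureDr !pure_in -!addrA; congr (_ + _).
Qed.

Lemma tens_der_pure A B (a : A) (b : B) :
  tens_der_fun (pure a b) = pure (dalg_der A a) b + pure a (dalg_der B b).
Proof. by rewrite /tens_der_fun lift_pure //; exact: tens_der_balanced. Qed.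

Lemma tens_derD A B : {morph @tens_der_fun A B : x y / x + y}.
Proof. by apply: liftD; exact: tens_der_balanced. Qed.

Lemma tens_derM A B (x y : A ⊗ B) :
  tens_der_fun (x * y) = tens_der_fun x * y + x * tens_der_fun y.
Proof.
elim/tens_ind: x => [a b|x x' ex ex']; last first.
  by rewrite mulrDl !tens_derD ex ex' !mulrDl addrACA.
elim/tens_ind: y => [a' b'|y y' ey ey']; last first.
  by rewrite mulrDr !tens_derD ey ey' !mulrDr addrACA.
rewrite pureM !tens_der_pure mulrDl mulrDr !pureM !derM pureDl pureDr.
by rewrite addrACA.
Qed.

Definition tens_der A B : derivation (A ⊗ B) :=
  Derivation (@tens_derD A B) (@tens_derM A B).

Lemma tens_der_in A B r : tens_der A B (alg_in (A ⊗ B) r) = alg_in (A ⊗ B) (d r).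
Proof.
rewrite /= /tens_in tens_der_pure dalg_der_in der1.
by rewrite (balanced0r _ (@pure_balanced _ A B)) addr0.
Qed.

Definition diff_tens A B : diff_algebra d := DiffAlgebra (@tens_der_in A B).

Definition diff_self : diff_algebra d :=
  @DiffAlgebra R d (self_alg R) d (fun r => erefl).

Definition mx_der_fun n (Z Y : 'M[R]_n) : 'M[R]_n :=
  map_mx d Y + Z *m Y - Y *m Z.

Lemma mx_derD n (Z : mx_alg R n) (X Y : mx_alg R n) :
  mx_der_fun Z (X + Y) = mx_der_fun Z X + mx_der_fun Z Y :> mx_alg R n.
Proof.
rewrite /mx_der_fun; have -> : map_mx d (X + Y) = map_mx d X + map_mx d Y.
  by apply/matrixP => i j; rewrite !mxE derD.
by rewrite mulmxDl mulmxDr opprD [U in U + _ = _]addrACA; exact: addrACA.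
Qed.

Lemma map_mx_derM n m p (X : 'M[R]_(n, m)) (Y : 'M[R]_(m, p)) :
  map_mx d (X *m Y) = map_mx d X *m Y + X *m map_mx d Y.
Proof.
apply/matrixP => i j; rewrite !mxE der_sum -big_split; apply: eq_bigr => k _.
by rewrite !mxE derM.
Qed.

Lemma mx_derM n (Z : mx_alg R n) (X Y : mx_alg R n) :
  mx_der_fun Z (X * Y) = mx_der_fun Z X * Y + X * mx_der_fun Z Y.
Proof.
rewrite /mx_der_fun [in LHS]map_mx_derM.
have E (S : pzRingType) (x y z x' y' : S) : x' * y + x * y' + z * (x * y)
    - x * y * z = (x' + z * x - x * z) * y + x * (y' + z * y - y * z).
  rewrite mulrBl mulrDl mulrBr mulrDr !mulrA [x * y' + _]addrC !addrA subrK.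
  by rewrite [_ + z * x * y]addrAC.
exact: (E (mx_alg R n)).
Qed.

Definition mx_der n (Z : 'M[R]_n) : derivation (mx_alg R n) :=
  Derivation (mx_derD Z) (mx_derM Z).

Lemma mx_der_in n (Z : 'M[R]_n) r :
  mx_der Z (alg_in (mx_alg R n) r) = alg_in (mx_alg R n) (d r).
Proof.
rewrite /= /mx_der_fun scalar_mxC addrK; apply/matrixP => i j; rewrite !mxE.
by case: eqP => _; rewrite ?mulr1n ?mulr0n ?der0.
Qed.

Definition diff_mx n (Z : 'M[R]_n) : diff_algebra d := DiffAlgebra (mx_der_in Z).

End DiffTheory.
Record azumaya_algebra (R : comPzRingType) := AzumayaAlgebra {
  az_alg :> algebra R;
  azP : azumaya az_alg
}.

Record diff_azumaya (R : comPzRingType) (d : derivation R) := DiffAzumaya {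
  daz_alg :> diff_algebra d;
  dazP : azumaya daz_alg
}.

Section BrauerMonoid.
Variable R : comPzRingType.

Definition az_tens (A B : azumaya_algebra R) : azumaya_algebra R :=
  AzumayaAlgebra (azumaya_tens (azP A) (azP B)).

Definition az_self : azumaya_algebra R := AzumayaAlgebra (azumaya_self R).

Definition az_mx n : azumaya_algebra R := AzumayaAlgebra (azumaya_mx R n).

Lemma alg_iso_refl (A : azumaya_algebra R) : alg_iso A A.
Proof. by apply/alg_isoP; exists id; exact: is_iso_id. Qed.

Lemma alg_iso_sym (A B : azumaya_algebra R) : alg_iso A B -> alg_iso B A.
Proof.
move/alg_isoP=> [f /is_iso_inv[g [hg _ _]]]; apply/alg_isoP; by exists g.
Qed.

Lemma alg_iso_trans (A B C : azumaya_algebra R) :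
  alg_iso A B -> alg_iso B C -> alg_iso A C.
Proof.
move=> /alg_isoP[f hf] /alg_isoP[g hg]; apply/alg_isoP.
by exists (g \o f); exact: is_iso_comp.
Qed.

Lemma alg_iso_tens (A A' B B' : azumaya_algebra R) :
  alg_iso A A' -> alg_iso B B' -> alg_iso (az_tens A B) (az_tens A' B').
Proof.
move=> /alg_isoP[f hf] /alg_isoP[g hg]; apply/alg_isoP.
by exists (tens_map f g); exact: tens_map_iso.
Qed.

Lemma alg_iso_assoc (A B C : azumaya_algebra R) :
  alg_iso (az_tens (az_tens A B) C) (az_tens A (az_tens B C)).
Proof. by apply/alg_isoP; exists (@tens_assoc _ A B C); exact: tens_assoc_iso. Qed.

Lemma alg_iso_swap (A B : azumaya_algebra R) :
  alg_iso (az_tens A B) (az_tens B A).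
Proof. by apply/alg_isoP; exists (@tens_swap _ A B); exact: tens_swap_iso. Qed.

Lemma alg_iso_unit (A : azumaya_algebra R) : alg_iso (az_tens az_self A) A.
Proof. by apply/alg_isoP; exists (@tens_unit _ A); exact: tens_unit_iso. Qed.

Definition az_data := PreMonoid alg_iso_refl alg_iso_sym alg_iso_trans
  alg_iso_tens alg_iso_assoc alg_iso_swap alg_iso_unit.

Definition MA : comm_monoid := class_monoid az_data.

Definition MA_class (A : azumaya_algebra R) : MA := @class az_data A.

Definition MM_pred (x : MA) : Prop := exists n, x = MA_class (az_mx n).

Lemma MM1 : MM_pred cm_one.
Proof.
exists 0; apply/(@classP az_data)/alg_isoP.
by exists (@scalar1_mx R); exact: scalar1_mx_iso.
Qed.

Lemma MM_mul x y : MM_pred x -> MM_pred y -> MM_pred (cm_mul x y).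
Proof.
move=> [n ->] [m ->]; exists (m + n * m.+1)%N.
rewrite [LHS](@class_mulE az_data); apply/(@classP az_data)/alg_isoP.
by exists (@tens_kron R n.+1 m.+1); exact: tens_kron_iso.
Qed.

Definition MM : submonoid MA := Submonoid MM1 MM_mul.

Definition BM : comm_monoid := monoid_quot MM.

End BrauerMonoid.

Section DiffBrauerMonoid.
Variables (R : comPzRingType) (d : derivation R).
Implicit Types A B C : diff_azumaya d.

Definition daz_tens A B : diff_azumaya d :=
  @DiffAzumaya R d (diff_tens A B) (azumaya_tens (dazP A) (dazP B)).

Definition daz_self : diff_azumaya d :=
  @DiffAzumaya R d (diff_self d) (azumaya_self R).

(* Sizes are shifted by one here and in az_mx: the matrices have size n + 1, so
   that n ranges over all natural numbers. *)
Definition daz_mx n (Z : 'M[R]_n.+1) : diff_azumaya d :=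
  @DiffAzumaya R d (diff_mx d Z) (azumaya_mx R n).

Lemma diff_isoP (A B : diff_algebra d) : diff_iso A B <->
  exists2 f : A -> B, is_iso f & forall x, f (dalg_der A x) = dalg_der B (f x).
Proof.
split=> [[f [bf fi fd]]|[f hf fd]].
  by exists f => //; split=> //; [exact: rmorphD|exact: rmorphM].
have [g e] := is_iso_rmorphism hf; case: hf => _ _ fi bf.
by exists g; rewrite e.
Qed.

Lemma diff_iso_refl A : diff_iso A A.
Proof. by apply/diff_isoP; exists id => //; exact: is_iso_id. Qed.

Lemma diff_iso_sym A B : diff_iso A B -> diff_iso B A.
Proof.
move/diff_isoP=> [f /is_iso_inv[g [hg fK gK]] fd]; apply/diff_isoP.
by exists g => // x; apply: (can_inj fK); rewrite fd !gK.
Qed.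

Lemma diff_iso_trans A B C : diff_iso A B -> diff_iso B C -> diff_iso A C.
Proof.
move=> /diff_isoP[f hf fd] /diff_isoP[g hg gd]; apply/diff_isoP.
by exists (g \o f) => [|x] /=; [exact: is_iso_comp | rewrite fd gd].
Qed.

Lemma diff_iso_tens A A' B B' : diff_iso A A' -> diff_iso B B' ->
  diff_iso (daz_tens A B) (daz_tens A' B').
Proof.
move=> /diff_isoP[f hf fd] /diff_isoP[g hg gd]; apply/diff_isoP.
exists (tens_map f g); first exact: tens_map_iso.
have [mD _ _ _] := tens_map_iso hf hg.
apply: tens_ext => [x y|x y|a b]; rewrite /= ?(tens_derD, mD) //.
by rewrite tens_map_pure // !tens_der_pure mD !tens_map_pure // fd gd.
Qed.

Lemma diff_iso_assoc A B C :
  diff_iso (daz_tens (daz_tens A B) C) (daz_tens A (daz_tens B C)).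
Proof.
apply/diff_isoP; exists (@tens_assoc _ A B C); first exact: tens_assoc_iso.
have mD := @tens_assocD _ A B C.
apply: tens_ext3 => [x y|x y|a b c]; rewrite /= ?(tens_derD, mD) //.
rewrite tens_assoc_pure !tens_der_pure /= !tens_der_pure.
by rewrite pureDl pureDr !mD !tens_assoc_pure addrA.
Qed.

Lemma diff_iso_swap A B : diff_iso (daz_tens A B) (daz_tens B A).
Proof.
apply/diff_isoP; exists (@tens_swap _ A B); first exact: tens_swap_iso.
have mD := @tens_swapD _ A B.
apply: tens_ext => [x y|x y|a b]; rewrite /= ?(tens_derD, mD) //.
by rewrite tens_swap_pure !tens_der_pure mD !tens_swap_pure addrC.
Qed.

Lemma diff_iso_unit A : diff_iso (daz_tens daz_self A) A.
Proof.
apply/diff_isoP; exists (@tens_unit _ A); first exact: tens_unit_iso.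
have mD := @tens_unitD _ A.
apply: tens_ext => [x y|x y|r a]; rewrite /= ?(tens_derD, mD, derD) //.
by rewrite tens_unit_pure tens_der_pure mD !tens_unit_pure derM dalg_der_in.
Qed.

Definition daz_data := PreMonoid diff_iso_refl diff_iso_sym diff_iso_trans
  diff_iso_tens diff_iso_assoc diff_iso_swap diff_iso_unit.

Definition MAdiff : comm_monoid := class_monoid daz_data.

Definition MAdiff_class (A : diff_azumaya d) : MAdiff := @class daz_data A.

Definition MMdiff_pred (x : MAdiff) : Prop :=
  exists n (Z : 'M[R]_n.+1), x = MAdiff_class (daz_mx Z).

Definition MM0diff_pred (x : MAdiff) : Prop :=
  exists n, x = MAdiff_class (daz_mx (0 : 'M[R]_n.+1)).

Lemma map_mx_kron n m (X : 'M[R]_n) (Y : 'M[R]_m) :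
  map_mx d (kron X Y) = kron (map_mx d X) Y + kron X (map_mx d Y).
Proof. by apply/matrixP => k l; rewrite !mxE derM. Qed.

Lemma diff_iso_kron n m (Z : 'M[R]_n.+1) (W : 'M[R]_m.+1) :
  diff_iso (diff_tens (diff_mx d Z) (diff_mx d W))
    (diff_mx d (kron Z 1%:M + kron 1%:M W)).
Proof.
apply/diff_isoP; exists (@tens_kron R n.+1 m.+1); first exact: tens_kron_iso.
have mD := @tens_kronD R n.+1 m.+1.
apply: tens_ext => [x y|x y|X Y]; rewrite /= ?(tens_derD, mD, mx_derD) //.
rewrite tens_kron_pure tens_der_pure mD !tens_kron_pure /= /mx_der_fun.
set W' := kron Z 1%:M + _.
have lW : W' *m kron X Y = kron (Z *m X) Y + kron X (W *m Y).
  by rewrite mulmxDl !kronM !mul1mx.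
have rW : kron X Y *m W' = kron (X *m Z) Y + kron X (Y *m W).
  by rewrite mulmxDr !kronM !mulmx1.
have kN1 U V : kron (- U) V = - kron U V :> 'M[R]_(n.+1 * m.+1).
  by apply/matrixP => i j; rewrite !mxE mulNr.
have kN2 U V : kron U (- V) = - kron U V :> 'M[R]_(n.+1 * m.+1).
  by apply/matrixP => i j; rewrite !mxE mulrN.
rewrite lW rW map_mx_kron !kronDl !kronDr kN1 kN2 opprD.
by rewrite [U in _ = U + _]addrACA; exact: addrACA.
Qed.

Lemma MM0diff1 : MM0diff_pred cm_one.
Proof.
exists 0; apply/(@classP daz_data)/diff_isoP.
exists (@scalar1_mx R); first exact: scalar1_mx_iso.
move=> r; exact/esym/(mx_der_in d 0 r).
Qed.

Lemma MMdiff1 : MMdiff_pred cm_one.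
Proof. by have [n e] := MM0diff1; exists n, 0. Qed.

Lemma MMdiffM x y : MMdiff_pred x -> MMdiff_pred y -> MMdiff_pred (cm_mul x y).
Proof.
move=> [n [Z ->]] [m [W ->]].
exists (m + n * m.+1)%N, (kron Z 1%:M + kron 1%:M W).
rewrite [LHS](@class_mulE daz_data).
by apply/(@classP daz_data); exact: diff_iso_kron.
Qed.

Lemma MM0diffM x y :
  MM0diff_pred x -> MM0diff_pred y -> MM0diff_pred (cm_mul x y).
Proof.
move=> [n ->] [m ->]; exists (m + n * m.+1)%N.
rewrite [LHS](@class_mulE daz_data); apply/(@classP daz_data).
have := @diff_iso_kron n m 0 0.
suff -> : kron (0 : 'M[R]_n.+1) 1%:M + kron 1%:M (0 : 'M[R]_m.+1) = 0 by [].
by apply/matrixP => i j; rewrite !mxE mul0r mulr0 addr0.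
Qed.

Definition MMdiff : submonoid MAdiff := Submonoid MMdiff1 MMdiffM.

Definition MM0diff : submonoid MAdiff := Submonoid MM0diff1 MM0diffM.

Definition BMdiff : comm_monoid := monoid_quot MM0diff.

Definition MBMdiff : submonoid BMdiff := sub_quot MM0diff MMdiff.

End DiffBrauerMonoid.

(* Main.v *)
(** Since [BM R] is trivial, a differential Azumaya algebra [A] satisfies
    [A ⊗ M_n(R) ≅ M_m(R)] as algebras for some [n], [m].  Carry the derivation
    of [A ⊗ (M_n(R), 0)] over to [M_m(R)].  A derivation [D] of [M_m(R)]
    extending [d] differs from the entrywise one by an inner derivation, so
    [A ⊗ (M_n(R), 0)] is some [(M_m(R), Z)], and [A] and [(M_m(R), Z)] have the
    same class modulo [MM0diff]. *)
Require Import Defs.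
From mathcomp Require Import all_boot all_algebra.

Set Implicit Arguments.
Unset Strict Implicit.
Unset Printing Implicit Defensive.

Import GRing.Theory.
Local Open Scope ring_scope.

Lemma quot_class_eq1 (M : comm_monoid) (N : submonoid M) (m : M) :
  quot_class N m = cm_one <->
  exists n1 n2, [/\ N n1, N n2 & cm_mul m n1 = n2].
Proof.
split=> [/(@classP (quot_pre N))[n1 [n2 [h1 h2 e]]]|[n1 [n2 [h1 h2 e]]]].
  by exists n1, n2; split=> //; rewrite e cm_mul1.
by apply/(@classP (quot_pre N)); exists n1, n2; split=> //; rewrite cm_mul1.
Qed.

Section MatrixDerivations.
Variables (R : comPzRingType) (d : derivation R) (n : nat).

Lemma der_mx_inner (D : derivation (mx_alg R n.+1)) :
  (forall r, D (r%:M : 'M_n.+1) = (d r)%:M) ->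
  exists Z : 'M_n.+1, forall Y : 'M_n.+1, D Y = mx_der_fun d Z Y.
Proof.
move=> Dscalar.
pose E (i j : 'I_n.+1) : 'M[R]_n.+1 := delta_mx i j.
have DM (X Y : 'M[R]_n.+1) : D (X *m Y) = (D X : 'M_n.+1) *m Y + X *m D Y.
  exact: derM.
pose Z : 'M_n.+1 := \sum_k (D (E k 0) : 'M_n.+1) *m E 0 k.
exists Z => Y.
(* Evaluate [\sum_i D (Y *m E i 0) *m E 0 i] by the Leibniz rule, and also by
   expanding [Y *m E i 0] in the [E k 0]. *)
suff eDY : D Y + Y *m Z = map_mx d Y + Z *m Y :> 'M_n.+1.
  by rewrite /mx_der_fun -eDY addrK.
have YE i : Y *m E i 0 = \sum_k (Y k i)%:M *m E k 0.
  rewrite {1}(matrix_sum_delta Y) mulmx_suml; apply: eq_bigr => k _.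
  rewrite mulmx_suml (bigD1 i) //= big1 => [|j /negPf nj].
    by rewrite addr0 -scalemxAl mul_delta_mx mul_scalar_mx.
  by rewrite -scalemxAl mul_delta_mx_cond nj mulr0n scaler0.
have EY k : \sum_i (Y k i)%:M *m E 0 i = E 0 k *m Y.
  rewrite {2}(matrix_sum_delta Y) mulmx_sumr [RHS](bigD1 k) //= [X in _ + X]big1.
    rewrite addr0 mulmx_sumr; apply: eq_bigr => i _.
    by rewrite -scalemxAr mul_delta_mx mul_scalar_mx.
  move=> j /negPf nj; rewrite mulmx_sumr big1 // => i _.
  by rewrite -scalemxAr mul_delta_mx_cond eq_sym nj mulr0n scaler0.
have sumE : \sum_i E i 0 *m E 0 i = 1%:M :> 'M[R]_n.+1.
  rewrite scalar_mx_sum_delta; apply: eq_bigr => i _.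
  by rewrite scale1r mul_delta_mx.
transitivity (\sum_i (D (Y *m E i 0) : 'M_n.+1) *m E 0 i).
  rewrite /Z -{1}[D Y]mulmx1 -sumE !mulmx_sumr -big_split /=.
  by apply: eq_bigr => i _; rewrite DM mulmxDl !mulmxA.
have Dsum i : (D (Y *m E i 0) : 'M_n.+1) =
    \sum_k ((d (Y k i))%:M *m E k 0 + (Y k i)%:M *m D (E k 0)).
  rewrite YE der_sum; apply: eq_bigr => k _.
  by rewrite DM Dscalar.
rewrite (eq_bigr (fun i => \sum_k ((d (Y k i))%:M *m E k 0 *m E 0 i
    + (Y k i)%:M *m D (E k 0) *m E 0 i))); last first.
  move=> i _; rewrite Dsum mulmx_suml; apply: eq_bigr => k _.
  by rewrite mulmxDl.
rewrite exchange_big /=.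
under eq_bigr do rewrite big_split /=.
rewrite big_split /=; congr (_ + _).
  rewrite [RHS]matrix_sum_delta; apply: eq_bigr => k _; apply: eq_bigr => i _.
  by rewrite -mulmxA mul_delta_mx mul_scalar_mx mxE.
rewrite /Z mulmx_suml; apply: eq_bigr => k _.
rewrite -mulmxA -EY mulmx_sumr; apply: eq_bigr => i _.
by rewrite -scalar_mxC !mulmxA.
Qed.

End MatrixDerivations.

Lemma diff_iso_mx (R : comPzRingType) (d : derivation R) (n : nat)
    (B : diff_algebra d) :
  alg_iso B (mx_alg R n.+1) -> exists Z : 'M_n.+1, diff_iso B (diff_mx d Z).
Proof.
move=> /alg_isoP[f f_iso]; have [fD fM f_in _] := f_iso.
have [g [[gD gM g_in _] fK gK]] := is_iso_inv f_iso.
pose Df (Y : mx_alg R n.+1) : mx_alg R n.+1 := f (dalg_der B (g Y)).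
have DfD (X Y : mx_alg R n.+1) : Df (X + Y) = Df X + Df Y.
  by rewrite /Df gD derD fD.
have DfM (X Y : mx_alg R n.+1) : Df (X * Y) = Df X * Y + X * Df Y.
  by rewrite /Df gM derM fD !fM !gK.
have [|Z eZ] := @der_mx_inner R d n (Derivation DfD DfM).
  by move=> r; rewrite /= /Df (g_in r) dalg_der_in f_in.
exists Z; apply/diff_isoP; exists f => // x.
by rewrite [RHS]/= -eZ /= /Df fK.
Qed.

Theorem corollary7 (R : comPzRingType) (d : derivation R) :
  (forall x : BM R, x = cm_one) -> MBMdiff d = full_submonoid (BMdiff d).
Proof.
move=> BM1; apply: submonoid_eqP => x; split=> // _.
elim/class_ind: x => a; elim/class_ind: a => A.
have /quot_class_eq1[_ [_ [[n ->] [m ->]]]] :=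
  BM1 (quot_class (MM R) (MA_class (AzumayaAlgebra (dazP A)))).
rewrite [LHS](@class_mulE (az_data R)) => /(@classP (az_data R)) An_mx.
have [Z AnZ] := @diff_iso_mx R d m (daz_tens A (daz_mx d (0 : 'M_n.+1))) An_mx.
exists (MAdiff_class (daz_mx d Z)); first by exists m, Z.
apply/(@classP (quot_pre (MM0diff d))).
exists (MAdiff_class (daz_mx d (0 : 'M_n.+1))), cm_one; split.
- by exists n.
- exact: sm_one.
rewrite [RHS]cm_mulC cm_mul1.
rewrite [LHS](@class_mulE (daz_data d)).
by apply/(@classP (daz_data d)).
Qed.
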